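(* Let $S$ be a subtractive semiring. Then the following statements are equivalent: (1) The semiring $S$ is 2-AB. (2) (a) The prime ideals of $S$ are comparable, and (b) if $\mathfrak{p}$ is a minimal prime ideal over a 2-absorbing ideal $\mathfrak{a}$ of $S$, then $\mathfrak{a}\mathfrak{m}=\mathfrak{p}$, where $\mathfrak{m}$ is the unique maximal ideal of $S$. (3) (a) The prime ideals of $S$ are comparable, and (b) for every prime ideal $\mathfrak{p}$ of $S$, $2\text{-}\mathrm{Min}_S(\mathfrak{p}^2)=\{\mathfrak{p}\}$.
   Context: A semiring is a set $S$ with operations $+,\cdot$ and elements $0\neq 1$ such that $(S,+,0)$ is a commutative monoid, $(S,\cdot,1)$ is a monoid, multiplication distributes over addition on both sides, and $a\cdot 0=0\cdot a=0$ for all $a\in S$. All semirings are assumed commutative (multiplication is commutative). An ideal of $S$ is a nonempty subset $\mathfrak{a}$ closed under addition with $sx\in\mathfrak{a}$ for all $s\in S$, $x\in\mathfrak{a}$; it is proper if $\mathfrak{a}\neq S$. The product of ideals is $IJ=\{\sum_{i=1}^n a_ib_i : a_i\in I,\ b_i\in J,\ n\in\mathbb{N}\}$, and $\mathfrak{p}^2=\mathfrak{p}\mathfrak{p}$. An ideal $\mathfrak{a}$ is subtractive if $x+y\in\mathfrak{a}$ and $x\in\mathfrak{a}$ imply $y\in\mathfrak{a}$ for all $x,y\in S$; $S$ is subtractive if every ideal of $S$ is subtractive. A proper ideal $\mathfrak{p}$ is prime if $ab\in\mathfrak{p}$ implies $a\in\mathfrak{p}$ or $b\in\mathfrak{p}$.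 Every proper ideal is contained in a maximal ideal and maximal ideals are prime; so if the prime ideals are comparable (any two prime ideals are related by inclusion), $S$ has a unique maximal ideal. A minimal prime ideal over $\mathfrak{a}$ is a prime ideal minimal (under inclusion) among the prime ideals containing $\mathfrak{a}$. A proper ideal $\mathfrak{a}$ is 2-absorbing if, for $x,y,z\in S$, $xyz\in\mathfrak{a}$ implies $xy\in\mathfrak{a}$ or $yz\in\mathfrak{a}$ or $xz\in\mathfrak{a}$. $S$ is a 2-AB semiring if every 2-absorbing ideal of $S$ is prime. For an ideal $\mathfrak{a}$, $2\text{-}\mathrm{Min}_S(\mathfrak{a})$ denotes the set of minimal 2-absorbing ideals over $\mathfrak{a}$, i.e. 2-absorbing ideals $\mathfrak{b}\supseteq\mathfrak{a}$ of $S$ such that there is no 2-absorbing ideal $\mathfrak{q}$ of $S$ with $\mathfrak{a}\subseteq\mathfrak{q}\subsetneq\mathfrak{b}$. *)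

(* Defs.v *)
From HB Require Import structures.
From mathcomp Require Import all_boot all_order all_algebra.
From mathcomp Require Import boolp classical_sets.

Set Implicit Arguments.
Unset Strict Implicit.
Unset Printing Implicit Defensive.

Import GRing.Theory.

Local Open Scope classical_set_scope.
Local Open Scope ring_scope.

(* The ideals of ring_quotient.v are decidable and require opposites, so ideals
   of a commutative semiring are introduced here as classical sets. *)
Section SemiringIdeals.
Variable S : comNzSemiRingType.
Implicit Types (a b p m q I J : set S).

Definition is_ideal a : Prop :=
  [/\ a !=set0,
      (forall x y, a x -> a y -> a (x + y)) &
      (forall s x, a x -> a (s * x))].

Definition is_proper_ideal a : Prop := is_ideal a /\ a <> setT.

Definition is_maximal_ideal m : Prop :=
  is_proper_ideal m /\ forall a, is_proper_ideal a -> m `<=` a -> a = m.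

Definition is_unique_maximal_ideal m : Prop :=
  is_maximal_ideal m /\ forall n : set S, is_maximal_ideal n -> n = m.

Definition is_prime_ideal p : Prop :=
  is_proper_ideal p /\ forall x y, p (x * y) -> p x \/ p y.

Definition is_2absorbing a : Prop :=
  is_proper_ideal a /\
  forall x y z, a (x * y * z) -> [\/ a (x * y), a (y * z) | a (x * z)].

Definition subtractive_ideal a : Prop :=
  forall x y, a (x + y) -> a x -> a y.

Definition ideal_mul I J : set S :=
  [set x | exists n (u v : 'I_n -> S),
     [/\ forall i, I (u i), forall i, J (v i) & x = \sum_(i < n) u i * v i]].

(* b is minimal among the sets that satisfy P and contain a *)
Definition minimal_over (P : set (set S)) a b : Prop :=
  [/\ P b, a `<=` b & ~ exists q, [/\ P q, a `<=` q & q `<` b]].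

Definition is_minimal_prime_over a p : Prop :=
  minimal_over is_prime_ideal a p.

Definition two_Min a : set (set S) :=
  [set b | minimal_over is_2absorbing a b].

End SemiringIdeals.

Definition subtractive_semiring (S : comNzSemiRingType) : Prop :=
  forall a : set S, is_ideal a -> subtractive_ideal a.

Definition two_AB_semiring (S : comNzSemiRingType) : Prop :=
  forall a : set S, is_2absorbing a -> is_prime_ideal a.

Definition primes_comparable (S : comNzSemiRingType) : Prop :=
  forall p q : set S, is_prime_ideal p -> is_prime_ideal q ->
    p `<=` q \/ q `<=` p.

(* Main.v *)
Require Import Defs.
From mathcomp Require Import all_boot all_order all_algebra.
From mathcomp Require Import boolp classical_sets.

(** If the primes form a chain, the intersection [p] of the primes containing a
    2-absorbing ideal [a] is prime, and it is the radical of [a]; the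
    2-absorbing property then gives [x ^+ 2] in [a] for [x] in [p], and applied
    to [x * (x + y) * y], together with subtractivity, it gives
    [p * p <= a <= p].  So minimality of [p] over [p * p] forces [a = p].
    In the other direction, [p :&: q] is 2-absorbing for all primes [p], [q],
    and [p * m] is 2-absorbing when [m] is the unique maximal ideal, because
    the elements outside [m] are units. *)

Import GRing.Theory.

Local Open Scope classical_set_scope.
Local Open Scope ring_scope.

Section Ideals.
Context {S : comNzSemiRingType}.
Implicit Types (a b p q m : set S) (x y z : S).

(** * Elementary closure properties and generated ideals *)

Lemma ideal0 {a} : is_ideal a -> a 0.
Proof. by case=> [[x ax] _ aM]; rewrite -(mul0r x); apply: aM. Qed.

Lemma idealD {a x y} : is_ideal a -> a x -> a y -> a (x + y).
Proof. by case=> _ + _; apply. Qed.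

Lemma idealMl {a} x {y} : is_ideal a -> a y -> a (x * y).
Proof. by case=> _ _; apply. Qed.

Lemma idealMr {a x} y : is_ideal a -> a x -> a (x * y).
Proof. by rewrite mulrC; apply: idealMl. Qed.

Lemma ideal_sum {a n} (f : 'I_n -> S) :
  is_ideal a -> (forall i, a (f i)) -> a (\sum_(i < n) f i).
Proof.
move=> ia af; elim/big_ind: _ => [|x y|i _]; [exact: ideal0 | exact: idealD|].
exact: af.
Qed.

Lemma ideal_proper {a} : is_ideal a -> ~ a 1 -> is_proper_ideal a.
Proof. by move=> ia na1; split=> // aT; apply: na1; rewrite aT. Qed.

Lemma proper_ideal1 {a} : is_proper_ideal a -> ~ a 1.
Proof.
move=> [ia aT] a1; apply: aT; apply/seteqP; split=> // x _.
by rewrite -(mulr1 x); apply: idealMl.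
Qed.

Lemma is_ideal_principal x : is_ideal [set y | exists s, y = s * x].
Proof.
split; first by exists (0 * x), 0.
- by move=> _ _ [s ->] [t ->]; exists (s + t); rewrite mulrDl.
- by move=> r _ [s ->]; exists (r * s); rewrite mulrA.
Qed.

Definition ideal_adjoin a x : set S :=
  [set y | exists2 u, a u & exists s, y = u + s * x].

Lemma is_ideal_adjoin {a} x : is_ideal a -> is_ideal (ideal_adjoin a x).
Proof.
move=> ia; split.
- by exists (0 + 0 * x), 0; [exact: ideal0 | exists 0].
- move=> _ _ [u au [s ->]] [v av [t ->]].
  exists (u + v); first exact: idealD.
  by exists (s + t); rewrite mulrDl addrACA.
- move=> r _ [u au [s ->]]; exists (r * u); first exact: idealMl.
  by exists (r * s); rewrite mulrDr mulrA.
Qed.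

Lemma sub_ideal_adjoin a x : a `<=` ideal_adjoin a x.
Proof. by move=> u au; exists u => //; exists 0; rewrite mul0r addr0. Qed.

Lemma mem_ideal_adjoin {a} x : is_ideal a -> ideal_adjoin a x x.
Proof. by move=> ia; exists 0; [exact: ideal0 | exists 1; rewrite mul1r add0r]. Qed.

(** * Existence of prime and maximal ideals *)

(** The exponent 0 is included, so an ideal with this property omits 1 and is proper. *)
Definition avoids_powers x a : Prop := forall n, ~ a (x ^+ n).

(** One application of Zorn's lemma serves two purposes: a general [x] yields primes that omit [x],
    and [x = 1] yields maximal ideals. *)
Lemma ex_maximal_avoiding {a x} : is_ideal a -> avoids_powers x a ->
  exists p, [/\ is_ideal p, avoids_powers x p, a `<=` p &
    forall b, is_ideal b -> avoids_powers x b -> p `<=` b -> b = p].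
Proof.
move=> ia nax.
pose good b := [/\ is_ideal b, avoids_powers x b & a `<=` b].
(* The guard makes the union of the empty chain an upper bound. *)
have [F Fgood Ftot|p [pgood pmax]] :=
    @Zorn_bigcup S [set b | b !=set0 -> good b].
  have {}Fgood b y : F b -> b y -> good b.
    by move=> Fb By; apply: Fgood => //; exists y.
  move=> [w [b0 Fb0 b0w]]; have [ib0 _ ab0] := Fgood _ _ Fb0 b0w; split.
  - split; first by exists w, b0.
    + move=> y z [b Fb By] [c Fc cz].
      have [ib _ _] := Fgood _ _ Fb By; have [ic _ _] := Fgood _ _ Fc cz.
      have [bc|cb] := Ftot _ _ Fb Fc.
        by exists c => //; apply: idealD => //; apply: bc.
      by exists b => //; apply: idealD => //; apply: cb.
    + move=> s y [b Fb By]; exists b => //.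
      by have [ib _ _] := Fgood _ _ Fb By; apply: idealMl.
  - by move=> n [b Fb bxn]; have [_ + _] := Fgood _ _ Fb bxn; apply; apply: bxn.
  - by move=> y /ab0 b0y; exists b0.
(* The guard lets the empty set through, but it is not maximal, since [a] lies strictly above it. *)
have [p0|/set0P/pgood [ip px ap]] := eqVneq p set0.
  have [] := pmax a; last by move=> _; split.
  by rewrite p0; split=> // /(_ 0); apply; apply: ideal0.
exists p; split=> // b ib bx pb; apply: contrapT => bNp.
have [] := pmax b; last by move=> _; split=> // y /ap /pb.
by split=> // bp; apply: bNp; apply/seteqP.
Qed.

(** Let [p] be maximal among the ideals avoiding the powers of [x]. If [y] and [z] lie outside [p],
    then [p + Sy] and [p + Sz] each contain a power of [x]. The product of these powers lies in
    [p + Syz], which is [p] as soon as [p] contains [y * z]. *)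
Lemma ex_prime_avoiding {a x} : is_ideal a -> avoids_powers x a ->
  exists2 p, is_prime_ideal p & a `<=` p /\ ~ p x.
Proof.
move=> ia /(ex_maximal_avoiding ia) [p [ip px ap pmax]].
exists p; last by split=> // pX; apply: (px 1%N); rewrite expr1.
split; first by apply: ideal_proper => //; apply: (px 0%N).
have adj y : ~ p y -> exists n, ideal_adjoin p y (x ^+ n).
  move=> npy; apply: contrapT => /forallNP av; apply: npy.
  rewrite -(pmax _ (is_ideal_adjoin y ip) av); first exact: mem_ideal_adjoin.
  exact: sub_ideal_adjoin.
move=> y z pyz; apply: contrapT => /not_orP [/adj [n [u pu [s xn]]]].
move=> /adj [k [v pv [t xk]]]; apply: (px (n + k)%N).
rewrite exprD xn xk mulrDl; apply: idealD => //; first exact: idealMr.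
by rewrite mulrDr mulrACA; apply: idealD => //; apply: idealMl.
Qed.

Lemma ex_maximal_ideal {a} : is_proper_ideal a ->
  exists2 m, is_maximal_ideal m & a `<=` m.
Proof.
move=> pa; have ia := pa.1.
have av b : is_proper_ideal b -> avoids_powers 1 b.
  by move=> pb n; rewrite expr1n; apply: proper_ideal1.
have [m [im m1 am mmax]] := ex_maximal_avoiding ia (av _ pa).
exists m => //; split; first by apply: ideal_proper => //; apply: (m1 0%N).
by move=> b pb; apply: mmax; [case: pb | exact: av].
Qed.

Lemma maximal_ideal_prime {m} : is_maximal_ideal m -> is_prime_ideal m.
Proof.
move=> [pm mmax]; have im := pm.1; split=> // x y mxy.
apply: contrapT => /not_orP [nmx nmy]; have ix := is_ideal_adjoin x im.
have [[u mu [s e1]]|nx1] := pselect (ideal_adjoin m x 1).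
  apply: nmy; rewrite -(mul1r y) e1 mulrDl -mulrA.
  by apply: idealD => //; [exact: idealMr | exact: idealMl].
apply: nmx; rewrite -(mmax _ (ideal_proper ix nx1)); first exact: mem_ideal_adjoin.
exact: sub_ideal_adjoin.
Qed.

Lemma ex_unique_maximal_ideal : primes_comparable S ->
  exists m, is_unique_maximal_ideal m.
Proof.
(* The zero ideal, written as a principal ideal; it is proper because [1] differs from [0]. *)
move=> comp; have [|m mm _] := @ex_maximal_ideal [set y | exists s, y = s * 0].
  apply: ideal_proper; first exact: is_ideal_principal.
  by move=> [s] /eqP; rewrite mulr0 oner_eq0.
exists m; split=> // n nm; have [pm mmax] := mm; have [pn nmax] := nm.
have [mn|nm'] := comp _ _ (maximal_ideal_prime mm) (maximal_ideal_prime nm).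
  exact: mmax.
by rewrite (nmax m).
Qed.

(** The principal ideal of a non-unit is proper, hence lies in some maximal ideal, which can only be
    [m]. *)
Lemma nmem_unique_maximal_unit {m x} : is_unique_maximal_ideal m -> ~ m x ->
  exists s, s * x = 1.
Proof.
move=> [_ muniq] nmx; apply: contrapT => nu; apply: nmx.
have [|n nm xn] := @ex_maximal_ideal [set y | exists s, y = s * x].
  apply: ideal_proper; first exact: is_ideal_principal.
  by move=> [s s1]; apply: nu; exists s.
by rewrite -(muniq _ nm); apply: xn; exists 1; rewrite mul1r.
Qed.

Lemma proper_sub_unique_maximal {m a} : is_unique_maximal_ideal m ->
  is_proper_ideal a -> a `<=` m.
Proof. by move=> [_ muniq] /ex_maximal_ideal [n /muniq ->]. Qed.

(** * 2-absorbing ideals and products of ideals *)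

Lemma prime_2absorbing {p} : is_prime_ideal p -> is_2absorbing p.
Proof.
move=> [pp pM]; split=> // x y z; have ip := pp.1.
case/pM => [/pM[px|py]|pz]; first by apply: Or31; apply: idealMr.
  by apply: Or31; apply: idealMl.
by apply: Or32; apply: idealMl.
Qed.

(** One of the three factors lies in [p] and one in [q]; a product of two factors that includes both
    lies in the intersection. *)
Lemma setI_prime_2absorbing {p q} : is_prime_ideal p -> is_prime_ideal q ->
  is_2absorbing (p `&` q).
Proof.
move=> [pp pM] [pq qM]; have ip := pp.1; have iq := pq.1.
have i : is_ideal (p `&` q).
  split; first by exists 0; split; apply: ideal0.
  - by move=> x y [px qx] [py qy]; split; apply: idealD.
  - by move=> s x [px qx]; split; apply: idealMl.
split; first by apply: ideal_proper => // -[/(proper_ideal1 pp)].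
move=> x y z [pxyz qxyz].
by case: (pM _ _ pxyz) => [/pM[]|] pt; case: (qM _ _ qxyz) => [/qM[]|] qt;
  solve [ by apply: Or31; split; (exact: idealMr || exact: idealMl)
        | by apply: Or32; split; (exact: idealMr || exact: idealMl)
        | by apply: Or33; split; (exact: idealMr || exact: idealMl) ].
Qed.

Lemma mem_ideal_mul {a b x y} : a x -> b y -> ideal_mul a b (x * y).
Proof.
move=> ax By; exists 1%N, (fun=> x), (fun=> y).
by split=> //; rewrite big_ord1.
Qed.

Lemma ideal_mul_sub {a b c : set S} : is_ideal c ->
  (forall x y, a x -> b y -> c (x * y)) -> ideal_mul a b `<=` c.
Proof.
by move=> ic abc _ [n [u [v [au bv ->]]]]; apply: ideal_sum => // i; apply: abc.
Qed.

Lemma is_ideal_mul {a b} : is_ideal a -> is_ideal (ideal_mul a b).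
Proof.
move=> ia; split.
- by exists 0, 0%N, (fun=> 0), (fun=> 0); split; [case|case|rewrite big_ord0].
- move=> _ _ [n [u [v [au bv ->]]]] [k [u' [v' [au' bv' ->]]]].
  (* The two families are concatenated; [split] tells which half an index comes from. *)
  exists (n + k)%N, (fun i => match split i with inl j => u j | inr j => u' j end),
    (fun i => match split i with inl j => v j | inr j => v' j end).
  split; [by move=> i; case: split|by move=> i; case: split|].
  rewrite big_split_ord; congr (_ + _); apply: eq_bigr => i _.
    by rewrite (unsplitK (inl i : 'I_n + 'I_k)).
  by rewrite (unsplitK (inr i : 'I_n + 'I_k)).
- move=> s _ [n [u [v [au bv ->]]]].
  exists n, (fun i => s * u i), v; split=> //; first by move=> i; apply: idealMl.
  by rewrite mulr_sumr; apply: eq_bigr => i _; rewrite mulrA.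
Qed.

Lemma ideal_mulSl {a b} : is_ideal a -> ideal_mul a b `<=` a.
Proof. by move=> ia; apply: ideal_mul_sub => // x y ax _; apply: idealMr. Qed.

Lemma prime_ideal_mul {a b p} : is_prime_ideal p ->
  ideal_mul a b `<=` p -> a `<=` p \/ b `<=` p.
Proof.
move=> [_ pM] abp; have [ap|/existsNP [x /not_implyP [ax npx]]] := pselect (a `<=` p).
  by left.
by right=> y By; have [] := pM _ _ (abp _ (mem_ideal_mul ax By)).
Qed.

(** Some factor, say [x], lies in [p]. Either [y] is in [m] and [x * y] is in the product, or [y]
    has an inverse [s] and [x * z = s * (x * y * z)]. *)
Lemma ideal_mul_maximal_2absorbing {p m} :
  is_unique_maximal_ideal m -> is_prime_ideal p ->
  is_2absorbing (ideal_mul p m).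
Proof.
move=> um [pp pM]; have ip := pp.1; have ipm := @is_ideal_mul p m ip.
have pm_p : ideal_mul p m `<=` p by apply: ideal_mulSl.
split; first by apply: ideal_proper => // /pm_p /(proper_ideal1 pp).
have key x y z : p x -> ideal_mul p m (x * y * z) ->
    ideal_mul p m (x * y) \/ ideal_mul p m (x * z).
  move=> px pxyz; have [my|nmy] := pselect (m y).
    by left; apply: mem_ideal_mul.
  have [s sy] := nmem_unique_maximal_unit um nmy; right.
  by rewrite -(mul1r z) -sy -mulrA mulrCA (mulrA x); apply: idealMl.
move=> x y z pxyz; case: (pM _ _ (pm_p _ pxyz)) => [/pM[px|py]|pz].
- by case: (key x y z) => // h; [apply: Or31 | apply: Or33].
- case: (key y x z) => // [|h|h]; first by rewrite (mulrC y).
    by apply: Or31; rewrite mulrC.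
  exact: Or32.
- case: (key z x y) => // [|h|h]; first by rewrite -mulrA mulrC.
    by apply: Or33; rewrite mulrC.
  by apply: Or32; rewrite mulrC.
Qed.

(** * Radicals of 2-absorbing ideals *)

Lemma minimal_prime_radical {a} : primes_comparable S -> is_proper_ideal a ->
  exists2 p, is_minimal_prime_over a p & forall x, p x -> exists n, a (x ^+ n).
Proof.
move=> comp pa; have ia := pa.1.
pose p := [set x | forall q, is_prime_ideal q -> a `<=` q -> q x].
have prad x : p x -> exists n, a (x ^+ n).
  move=> px; apply: contrapT => /forallNP /(ex_prime_avoiding ia) [q qp [aq]].
  by apply; apply: px.
have pq q : is_prime_ideal q -> a `<=` q -> p `<=` q by move=> qp aq x; apply.
have pprime : is_prime_ideal p.
  split.
    apply: ideal_proper; last first.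
      by move=> /prad [n]; rewrite expr1n; apply: proper_ideal1.
    split; first by exists 0 => q qp _; apply: ideal0 qp.1.1.
    - by move=> x y px py q qp aq; apply: (idealD qp.1.1); [exact: px | exact: py].
    - by move=> s x px q qp aq; apply: (idealMl s qp.1.1); apply: px.
  move=> x y pxy; apply: contrapT => /not_orP [].
  move=> /existsNP [q /not_implyP [qp /not_implyP [aq nqx]]].
  move=> /existsNP [r /not_implyP [rp /not_implyP [ar nry]]].
  (* The smaller of [q] and [r] omits both [x] and [y] but contains [x * y]. *)
  have [qr|rq] := comp _ _ qp rp.
    have [//|/qr//] := qp.2 _ _ (pxy _ qp aq).
  by have [/rq|] := rp.2 _ _ (pxy _ rp ar).
exists p => //; split=> //; first by move=> x ax q _; apply.
by move=> [q [qp aq [_]]]; apply; apply: pq.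
Qed.

(** Splitting [x ^+ n.+3] as [x * x * x ^+ n.+1] yields either the square or the power [x ^+ n.+2],
    so the exponent descends to 2. *)
Lemma absorbing_sqr {a x} n : is_2absorbing a -> a (x ^+ n) -> a (x ^+ 2).
Proof.
move=> [pa aM]; have ia := pa.1.
elim: n => [|n IH axn]; first by rewrite expr0 => /(proper_ideal1 pa).
case: n => [|[//|n]] in IH axn *.
  by rewrite expr2; apply: idealMl.
case: (aM x x (x ^+ n.+1)) => //; first by rewrite -mulrA -!exprS.
all: by rewrite -?exprS => ?; apply: IH.
Qed.

Lemma radical_sqr_sub {a p} : subtractive_semiring S -> is_2absorbing a ->
  (forall x, p x -> exists n, a (x ^+ n)) -> ideal_mul p p `<=` a.
Proof.
move=> hS aa prad; have ia := aa.1.1.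
apply: ideal_mul_sub => // x y /prad [n /(absorbing_sqr _ aa) ax2].
move=> /prad [k /(absorbing_sqr _ aa) ay2].
have : a (x * (x + y) * y).
  rewrite mulrDr mulrDl; apply: idealD => //; first exact: idealMr.
  by rewrite -mulrA; apply: idealMl.
(* The alternatives are [x * (x + y)], [(x + y) * y] and [x * y]; in the first two, subtractivity
   removes the square. *)
case/aa.2 => //.
- by rewrite mulrDr => h; apply: hS ia _ _ h ax2.
- by rewrite mulrDl addrC => h; apply: hS ia _ _ h ay2.
Qed.

(** * Consequences of the 2-AB property *)

(** The intersection of [p] and [q] is 2-absorbing, hence prime, and it contains their product, so
    it contains one of them. *)
Lemma two_AB_primes_comparable : two_AB_semiring S -> primes_comparable S.
Proof.
move=> AB p q pp pq; have ip := pp.1.1; have iq := pq.1.1.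
have : ideal_mul p q `<=` p `&` q.
  by move=> x h; split; apply: ideal_mul_sub h => // y z py qz;
    [exact: idealMr | exact: idealMl].
move=> /(prime_ideal_mul (AB _ (setI_prime_2absorbing pp pq))).
by case=> h; [left|right] => x /h [].
Qed.

(** The product is prime and contains itself, so it contains [p] or [m]; in either case it contains
    [p]. *)
Lemma two_AB_mul_maximal m p : two_AB_semiring S ->
  is_unique_maximal_ideal m -> is_prime_ideal p -> ideal_mul p m = p.
Proof.
move=> AB um pp; apply/seteqP; split; first exact: ideal_mulSl pp.1.1.
have pmP := AB _ (ideal_mul_maximal_2absorbing um pp).
have [//|mpm x px] := prime_ideal_mul pmP (@subset_refl _ _).
by apply: mpm; apply: (proper_sub_unique_maximal um pp.1).
Qed.

Lemma minimal_prime_over_prime {a p} : is_prime_ideal a ->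
  is_minimal_prime_over a p -> p = a.
Proof.
move=> pa [pp ap nq]; apply/seteqP; split=> //.
by apply: contrapT => pNa; apply: nq; exists a; split.
Qed.

Lemma two_AB_two_Min p : two_AB_semiring S -> is_prime_ideal p ->
  two_Min (ideal_mul p p) = [set p].
Proof.
move=> AB pp; have p2p := @ideal_mulSl p p pp.1.1.
have sub q : is_2absorbing q -> ideal_mul p p `<=` q -> p `<=` q.
  by move=> /AB qp /(prime_ideal_mul qp) [].
apply/seteqP; split=> [q [qa p2q nq]|_ ->].
  apply/seteqP; split; last exact: sub.
  by apply: contrapT => h; apply: nq; exists p; split=> //;
    [exact: prime_2absorbing | split=> //; exact: sub].
split=> //; first exact: prime_2absorbing.
by move=> [q [qa p2q [_]]]; apply; apply: sub.
Qed.

End Ideals.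

Theorem theorem4p6 (S : comNzSemiRingType) (hS : subtractive_semiring S) :
  [<-> two_AB_semiring S;
       primes_comparable S /\
       (exists2 m : set S, is_unique_maximal_ideal m &
          forall a p : set S, is_2absorbing a -> is_minimal_prime_over a p ->
            ideal_mul a m = p);
       primes_comparable S /\
       (forall p : set S, is_prime_ideal p ->
          two_Min (ideal_mul p p) = [set p])].
Proof.
tfae.
- move=> AB; have comp := two_AB_primes_comparable AB; split=> //.
  have [m um] := ex_unique_maximal_ideal comp; exists m => // a p /AB pa.
  by move=> /(minimal_prime_over_prime pa) ->; apply: two_AB_mul_maximal.
(* The 2-AB property is recovered on the way: [q = a * m] is contained in [a], so [a] equals the
   prime [q]. *)
- move=> [comp [m um amp]]; split=> // p pp; apply: two_AB_two_Min => // a aa.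
  have [q qmin _] := minimal_prime_radical comp aa.1; have [qp aq _] := qmin.
  suff -> : a = q by [].
  apply/seteqP; split=> //; rewrite -(amp _ _ aa qmin).
  exact: ideal_mulSl aa.1.1.
- move=> [comp min] a aa.
  have [p [pp ap _] prad] := minimal_prime_radical comp aa.1.
  (* If [a] were strictly below [p], it would be a 2-absorbing ideal containing [p * p] that
     contradicts the minimality of [p]. *)
  have [_ _ nq] : two_Min (ideal_mul p p) p by rewrite min.
  suff -> : a = p by [].
  apply/seteqP; split=> //; apply: contrapT => npa; apply: nq; exists a.
  by split=> //; exact: radical_sqr_sub.
Qed.
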